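(* Let $\varphi(z)=1+B_1z+B_2z^2+B_3z^3+\cdots$ be analytic in $\mathbb{D}$ with $B_1>0$ and $B_2\in\mathbb{R}$. Let $f(z)=z+\sum_{n\ge2}a_nz^n$ belong to $\sigma$, with inverse $F=f^{-1}$ on $\mathbb{D}$, and suppose \[1+\frac{zf''(z)}{f'(z)}\prec\varphi(z)\quad\text{and}\quad 1+\frac{wF''(w)}{F'(w)}\prec\varphi(w)\] (i.e. $f\in\mathcal{K}_\sigma(\varphi)$). Then \[|a_2|\le\min\left\{\sqrt{\frac{B_1^2+B_1+|B_2-B_1|}{6}},\ \frac{B_1}{2}\right\}\quad\text{and}\quad |a_3|\le\min\left\{\frac{B_1^2+B_1+|B_2-B_1|}{6},\ \frac{B_1(3B_1+2)}{12}\right\}.\]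
   Context: $\mathbb{D}=\{z\in\mathbb{C}:|z|<1\}$. $\mathcal{A}$ denotes the class of analytic functions $f$ on $\mathbb{D}$ with $f(0)=0$, $f'(0)=1$, i.e. $f(z)=z+\sum_{n\ge2}a_nz^n$. The class $\sigma$ of bi-univalent functions consists of those $f\in\mathcal{A}$ that are univalent in $\mathbb{D}$ and whose inverse $f^{-1}$ (defined near $0$) extends to a univalent analytic function $F$ on $\mathbb{D}$; then $F(w)=w-a_2w^2+(2a_2^2-a_3)w^3+\cdots$. For analytic $g,h$ on $\mathbb{D}$, $g\prec h$ (subordination) means there is an analytic $\omega:\mathbb{D}\to\mathbb{D}$ with $\omega(0)=0$ and $g=h\circ\omega$. *)

(* Defs.v *)
From Stdlib Require Import Reals.
Open Scope R_scope.

Record Cplx : Type := mkC { Re : R; Im : R }.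

Definition RtoC (x : R) : Cplx := mkC x 0.
Definition Czero : Cplx := RtoC 0.
Definition Cone : Cplx := RtoC 1.
Definition Cadd (a b : Cplx) : Cplx := mkC (Re a + Re b) (Im a + Im b).
Definition Copp (a : Cplx) : Cplx := mkC (- Re a) (- Im a).
Definition Csub (a b : Cplx) : Cplx := Cadd a (Copp b).
Definition Cmul (a b : Cplx) : Cplx :=
  mkC (Re a * Re b - Im a * Im b) (Re a * Im b + Im a * Re b).
Definition Cinv (a : Cplx) : Cplx :=
  mkC (Re a / (Re a * Re a + Im a * Im a)) (- Im a / (Re a * Re a + Im a * Im a)).
Definition Cdiv (a b : Cplx) : Cplx := Cmul a (Cinv b).
Definition Cnorm (a : Cplx) : R := sqrt (Re a * Re a + Im a * Im a).

Definition inD (z : Cplx) : Prop := Cnorm z < 1.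

Definition has_cderiv (f : Cplx -> Cplx) (z l : Cplx) : Prop :=
  forall eps : R, 0 < eps -> exists delta : R, 0 < delta /\
    forall h : Cplx, h <> Czero -> Cnorm h < delta ->
      Cnorm (Csub (Cdiv (Csub (f (Cadd z h)) (f z)) h) l) < eps.

Definition holo_D (f f' : Cplx -> Cplx) : Prop :=
  forall z, inD z -> has_cderiv f z (f' z).

Definition analytic_D (f : Cplx -> Cplx) : Prop := exists f', holo_D f f'.

Definition univalent_D (f : Cplx -> Cplx) : Prop :=
  analytic_D f /\ forall z1 z2, inD z1 -> inD z2 -> f z1 = f z2 -> z1 = z2.

Definition subord (g h : Cplx -> Cplx) : Prop :=
  exists w : Cplx -> Cplx, analytic_D w /\ (forall z, inD z -> inD (w z)) /\
    w Czero = Czero /\ forall z, inD z -> g z = h (w z).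

Definition in_A (f f' : Cplx -> Cplx) : Prop := holo_D f f' /\ f Czero = Czero /\ f' Czero = Cone.

(* F is the extension to D of f^{-1}: F is univalent on D and coincides with
   f^{-1} near 0, i.e. F(w) lies in D and f(F(w)) = w for |w| small. *)
Definition bi_univalent_with_inverse (f F : Cplx -> Cplx) : Prop :=
  univalent_D f /\ univalent_D F /\
  exists r : R, 0 < r /\ forall w, Cnorm w < r -> inD (F w) /\ f (F w) = w.

Definition conv_expr (g' g'' : Cplx -> Cplx) (z : Cplx) : Cplx :=
  Cadd Cone (Cdiv (Cmul z (g'' z)) (g' z)).

(* Main.v *)
(** Write a2, a3 for the coefficients of f and w, v for the Schwarz functions of
    the two subordinations, w(z) = c1 z + c2 z^2 + ..., v(z) = d1 z + d2 z^2 + ....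
    Comparing coefficients in 1 + z f''/f' = phi(w), and likewise for F, gives
      2 a2 = B1 c1,   6 a3 - 4 a2^2 = B1 c2 + B2 c1^2,
     -2 a2 = B1 d1,   8 a2^2 - 6 a3 = B1 d2 + B2 d1^2,
    so d1 = -c1, and all four bounds follow from |c2| + |c1|^2 <= 1,
    |d2| + |d1|^2 <= 1: adding the second-order equations controls 4 a2^2,
    subtracting them controls 12 (a3 - a2^2).

    The inequality |c2| + |c1|^2 <= 1 comes from the mean over |z| = r of
    w(z) (1 + eta z)^2 / z^2. This mean is c2 + 2 eta c1, and it is at most the
    mean of |1 + eta z|^2 / r^2, that is, 1/r^2 + |eta|^2; let r tend to 1 and
    choose eta. That the mean does not depend on r is Cauchy's theorem for an
    annulus: in the coordinates z = e^(s+it) it is Goursat's theorem for a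
    rectangle, two sides of which cancel by periodicity. *)

From Stdlib Require Import Reals Lra Psatz ClassicalChoice.
From Coquelicot Require Import Coquelicot.
Require Defs.
Open Scope R_scope.

(** * Complex derivatives *)

(** The target is [C] as a module over itself, because [is_derive_mult] and [is_derive_comp] are
    stated for that structure. *)
Definition cderiv (f : C -> C) (z l : C) : Prop :=
  @is_derive C_AbsRing (AbsRing_NormedModule C_AbsRing) f z l.

(** The filter definition reduces to an increment form, without quotients and with [h = 0] allowed.
    The estimates made by hand below all use it. *)
Lemma cderiv_eps (f : C -> C) (z l : C) :
  cderiv f z l <->
  forall eps, 0 < eps -> exists d, 0 < d /\ forall h, Cmod h < d ->
    Cmod (f (z + h) - f z - l * h)%C <= eps * Cmod h.
Proof.
split.
- intros [_ H] eps Heps.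
  destruct (H z (fun P HP => HP) (mkposreal eps Heps)) as [d Hd].
  exists d; split; [apply cond_pos|]. intros h Hh.
  assert (Hb : ball (M := AbsRing_UniformSpace C_AbsRing) z d (z + h)%C).
  { change (Cmod (z + h - z)%C < d). now replace (z + h - z)%C with h by ring. }
  specialize (Hd _ Hb).
  change (Cmod (f (z + h) - f z - (z + h - z) * l)%C <= eps * Cmod (z + h - z)%C) in Hd.
  replace (z + h - z)%C with h in Hd by ring.
  now replace (l * h)%C with (h * l)%C by ring.
- intros H. split; [apply (is_linear_scal_l (K := C_AbsRing))|].
  intros x Hx.
  assert (Ex : x = z).
  { symmetry.
    apply (is_filter_lim_locally_unique (K:=C_AbsRing) (V := AbsRing_NormedModule C_AbsRing)).
    exact Hx. }
  subst x. intros eps.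
  destruct (H eps (cond_pos eps)) as [d [Hd0 Hd]].
  exists (mkposreal d Hd0). intros y Hy.
  change (Cmod (y - z)%C < d) in Hy.
  specialize (Hd (y - z)%C Hy).
  change (Cmod (f y - f z - (y - z) * l)%C <= eps * Cmod (y - z)%C).
  rewrite (Cmult_comm (y - z) l).
  assert (E : forall w : C, (z + (w - z))%C = w) by (intros; ring).
  now rewrite E in Hd.
Qed.

(** At a small real increment [x] the two linear approximations differ by [|l1 - l2| x], yet each is
    within a third of that of the same increment of [f]. *)
Lemma cderiv_unique (f : C -> C) (z l1 l2 : C) : cderiv f z l1 -> cderiv f z l2 -> l1 = l2.
Proof.
intros H1 H2.
destruct (Ceq_dec l1 l2) as [E|E]; [exact E|exfalso].
assert (Hp : 0 < Cmod (l1 - l2)%C).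
{ apply Cmod_gt_0. intros E0. apply E.
  replace l1 with (l1 - l2 + l2)%C by ring. rewrite E0. ring. }
set (e := Cmod (l1 - l2)%C / 3).
assert (He : 0 < e) by (unfold e; lra).
destruct (proj1 (cderiv_eps _ _ _) H1 e He) as [d1 [D1 K1]].
destruct (proj1 (cderiv_eps _ _ _) H2 e He) as [d2 [D2 K2]].
set (x := Rmin d1 d2 / 2).
assert (Hx : 0 < x /\ x < d1 /\ x < d2).
{ unfold x. pose proof (Rmin_l d1 d2). pose proof (Rmin_r d1 d2).
  pose proof (Rmin_glb_lt _ _ _ D1 D2). lra. }
assert (Ex : Cmod (RtoC x) = x) by (rewrite Cmod_R; apply Rabs_pos_eq; lra).
specialize (K1 (RtoC x)). specialize (K2 (RtoC x)). rewrite Ex in K1, K2.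
specialize (K1 ltac:(lra)). specialize (K2 ltac:(lra)).
pose proof (Cmod_triangle (f (z + RtoC x) - f z - l2 * RtoC x)%C
   (- (f (z + RtoC x) - f z - l1 * RtoC x))%C) as T.
rewrite Cmod_opp in T.
replace (f (z + RtoC x) - f z - l2 * RtoC x + - (f (z + RtoC x) - f z - l1 * RtoC x))%C
  with ((l1 - l2) * RtoC x)%C in T by ring.
rewrite Cmod_mult, Ex in T.
assert (3 * e = Cmod (l1 - l2)%C) by (unfold e; lra). nra.
Qed.

Lemma cderiv_ext_near (f g : C -> C) z l r :
  0 < r -> (forall w, Cmod (w - z)%C < r -> f w = g w) ->
  cderiv f z l -> cderiv g z l.
Proof.
intros Hr He. apply is_derive_ext_loc.
exists (mkposreal r Hr). intros y Hy. now apply He.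
Qed.

Lemma cderiv_id (z : C) : cderiv (fun w => w) z 1.
Proof. exact (is_derive_id (K := C_AbsRing) z). Qed.

Lemma cderiv_const (a z : C) : cderiv (fun _ => a) z 0.
Proof. exact (is_derive_const (K := C_AbsRing) (V := AbsRing_NormedModule C_AbsRing) a z). Qed.

Lemma cderiv_plus (f g : C -> C) (z l m : C) :
  cderiv f z l -> cderiv g z m -> cderiv (fun w => f w + g w)%C z (l + m)%C.
Proof. exact (is_derive_plus (K := C_AbsRing) (V := AbsRing_NormedModule C_AbsRing) f g z l m). Qed.

Lemma cderiv_mult (f g : C -> C) (z l m : C) :
  cderiv f z l -> cderiv g z m ->
  cderiv (fun w => f w * g w)%C z (l * g z + f z * m)%C.
Proof.
intros Hf Hg.
exact (is_derive_mult (K := C_AbsRing) f g z l m Hf Hg Cmult_comm).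
Qed.

Lemma cderiv_comp (f g : C -> C) (z l m : C) :
  cderiv f (g z) l -> cderiv g z m -> cderiv (fun w => f (g w)) z (m * l)%C.
Proof. exact (is_derive_comp (K := C_AbsRing) (V := AbsRing_NormedModule C_AbsRing) f g z l m). Qed.

Lemma cderiv_opp (f : C -> C) (z l : C) : cderiv f z l -> cderiv (fun w => - f w)%C z (- l)%C.
Proof. exact (is_derive_opp (K := C_AbsRing) (V := AbsRing_NormedModule C_AbsRing) f z l). Qed.

Lemma cderiv_Cinv (z : C) : z <> 0 -> cderiv Cinv z (- / (z * z))%C.
Proof.
intros Hz. apply cderiv_eps. intros eps Heps.
assert (Hm : 0 < Cmod z) by now apply Cmod_gt_0.
set (m := Cmod z) in *.
(* The remainder is exactly [h^2 / (z^2 (z + h))]. The first bound keeps [|z + h|] above [m / 2];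
   the second then makes the remainder at most [eps |h|]. *)
exists (Rmin (m / 2) (eps * (m * m * m) / 2)). split.
{ apply Rmin_glb_lt; [lra|]. assert (0 < m * m * m) by (repeat apply Rmult_lt_0_compat; lra). nra. }
intros h Hh.
assert (H1 : Cmod h < m / 2) by (eapply Rlt_le_trans; [exact Hh|apply Rmin_l]).
assert (H2 : Cmod h < eps * (m * m * m) / 2) by (eapply Rlt_le_trans; [exact Hh|apply Rmin_r]).
assert (H3 : m / 2 < Cmod (z + h)%C).
{ pose proof (Cmod_triangle (z + h)%C (- h)%C) as T. rewrite Cmod_opp in T.
  replace (z + h + - h)%C with z in T by ring. fold m in T. lra. }
assert (Hzh : (z + h)%C <> 0) by (apply Cmod_gt_0; lra).
replace (/ (z + h) - / z - - / (z * z) * h)%C with (h * (h * / (z * z * (z + h))))%C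
  by (field; split; assumption).
rewrite Cmod_mult, Rmult_comm. apply Rmult_le_compat_r; [apply Cmod_ge_0|].
assert (Hn : (z * z * (z + h))%C <> 0).
{ repeat apply Cmult_neq_0; assumption. }
rewrite Cmod_mult, Cmod_inv, !Cmod_mult by exact Hn. fold m.
set (k := Cmod (z + h)%C) in *.
assert (0 < m * m) by nra.
assert (0 < m * m * k) by nra.
apply (Rmult_le_reg_r (m * m * k)); [assumption|].
rewrite Rmult_assoc, Rinv_l, Rmult_1_r by lra.
apply Rle_trans with (eps * (m * m * m) / 2); [lra|].
replace (eps * (m * m * m) / 2) with (eps * (m * m * (m / 2))) by field.
apply Rmult_le_compat_l; [lra|]. apply Rmult_le_compat_l; lra.
Qed.

Lemma cderiv_inv (f : C -> C) (z l : C) :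
  f z <> 0 -> cderiv f z l -> cderiv (fun w => / f w)%C z (- (l / (f z * f z)))%C.
Proof.
intros Hz Hf. replace (- (l / (f z * f z)))%C with (l * (- / (f z * f z)))%C.
- apply (cderiv_comp Cinv f); [now apply cderiv_Cinv|exact Hf].
- unfold Cdiv. field; repeat apply Cmult_neq_0; assumption.
Qed.

(** Multiplication by [l] is a real linear map, and its matrix gives the Cauchy-Riemann equations.
    Joint differentiability, more than partial derivatives, is what the chain rule in polar
    coordinates requires. *)
Lemma cderiv_re_im (f : C -> C) (x y : R) (l : C) :
  cderiv f (x, y) l ->
  differentiable_pt_lim (fun x y => fst (f (x, y))) x y (fst l) (- snd l) /\
  differentiable_pt_lim (fun x y => snd (f (x, y))) x y (snd l) (fst l).
Proof.
intros Hf.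
assert (H : forall eps : posreal, exists d : posreal, forall u v,
  Rabs (u - x) < d -> Rabs (v - y) < d ->
  Cmod (f (u, v) - f (x, y) - l * ((u - x)%R, (v - y)%R))%C
    <= eps * Rmax (Rabs (u - x)) (Rabs (v - y))).
{ intros eps.
  (* The modulus is at most [sqrt 2 <= 2] times the maximum norm in [differentiable_pt_lim], hence
     the halved [eps] and [d]. *)
  assert (He : 0 < eps / 2) by (pose proof (cond_pos eps); lra).
  destruct (proj1 (cderiv_eps _ _ _) Hf _ He) as [d [Hd K]].
  exists (mkposreal (d / 2) ltac:(lra)). intros u v Hu Hv. simpl in Hu, Hv.
  assert (Hmax : Cmod (u - x, v - y) <= 2 * Rmax (Rabs (u - x)) (Rabs (v - y))).
  { eapply Rle_trans; [apply Cmod_2Rmax|]. cbn [fst snd].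
    apply Rmult_le_compat_r; [eapply Rle_trans; [apply Rabs_pos|apply Rmax_l]|].
    apply Rsqr_incr_0_var; [unfold Rsqr; rewrite sqrt_sqrt; lra|lra]. }
  assert (Hlt : Rmax (Rabs (u - x)) (Rabs (v - y)) < d / 2) by now apply Rmax_lub_lt.
  specialize (K (u - x, v - y) ltac:(lra)).
  replace ((x, y) + ((u - x)%R, (v - y)%R))%C with (u, v) in K
    by (unfold Cplus; simpl; f_equal; ring).
  eapply Rle_trans; [exact K|].
  replace (eps * Rmax (Rabs (u - x)) (Rabs (v - y)))
    with (eps / 2 * (2 * Rmax (Rabs (u - x)) (Rabs (v - y)))) by field.
  apply Rmult_le_compat_l; lra. }
split; intros eps; destruct (H eps) as [d K]; exists d; intros u v Hu Hv;
  refine (Rle_trans _ _ _ _ (K u v Hu Hv));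
  (eapply Rle_trans; [|apply Rmax_Cmod]).
- eapply Rle_trans; [|apply Rmax_l]. right. f_equal. cbn. ring.
- eapply Rle_trans; [|apply Rmax_r]. right. f_equal. cbn. ring.
Qed.

(** * Goursat's theorem on rectangles *)

Lemma differentiable_slices (u : R -> R -> R) x y p q :
  differentiable_pt_lim u x y p q ->
  continuous (fun t => u t y) x /\ continuous (fun t => u x t) y.
Proof.
intros H.
assert (Hc : continuity_2d_pt u x y).
{ apply differentiable_continuity_pt. now exists p, q. }
split; apply continuity_pt_filterlim, continuity_pt_locally; intros eps;
  destruct (Hc eps) as [d Hd]; exists d; intros z Hz; apply Hd; try exact Hz;
  rewrite Rminus_eq_0, Rabs_R0; apply cond_pos.
Qed.

Lemma RInt_Rplus (f g : R -> R) a b : ex_RInt f a b -> ex_RInt g a b ->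
  RInt (fun t => f t + g t) a b = RInt f a b + RInt g a b.
Proof. exact (RInt_plus (V := R_CompleteNormedModule) f g a b). Qed.

Lemma RInt_Rconst (w a b : R) : RInt (fun _ => w) a b = (b - a) * w.
Proof. exact (RInt_const (V := R_CompleteNormedModule) a b w). Qed.

Lemma RInt_RChasles (f : R -> R) a b c : ex_RInt f a b -> ex_RInt f b c ->
  RInt f a c = RInt f a b + RInt f b c.
Proof. intros H K. symmetry. exact (RInt_Chasles (V := R_CompleteNormedModule) f a b c H K). Qed.

(* The imaginary part of the integral of u + iv along the positively oriented
   boundary of [a, b] x [c, d]. *)
Definition rect_int (u v : R -> R -> R) (a b c d : R) : R :=
  RInt (fun s => v s c - v s d) a b + RInt (fun t => u b t - u a t) c d.

(** These are the Cauchy-Riemann equations, [p + iq] being the derivative of [u + iv]. Continuity of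
    [p] and [q] is not known, so the integral is treated by bisection and not by Green's formula. *)
Definition holo_rect (u v : R -> R -> R) (a b c d : R) : Prop :=
  forall x y, a <= x <= b -> c <= y <= d -> exists p q,
    differentiable_pt_lim u x y p (- q) /\ differentiable_pt_lim v x y q p.

Section Rect.
Variables (u v : R -> R -> R) (a b c d : R).
Hypothesis (Hab : a <= b) (Hcd : c <= d) (Huv : holo_rect u v a b c d).

Lemma holo_rect_ex_RInt_x y1 y2 x1 x2 :
  c <= y1 <= d -> c <= y2 <= d -> a <= x1 -> x1 <= x2 -> x2 <= b ->
  ex_RInt (fun s => v s y1 - v s y2) x1 x2.
Proof.
intros H1 H2 H3 H4 H5.
apply (ex_RInt_continuous (V := R_CompleteNormedModule)). intros z Hz.
rewrite Rmin_left, Rmax_right in Hz by lra.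
apply (continuous_minus (V := R_NormedModule));
  [destruct (Huv z y1) as (p & q & _ & K)|destruct (Huv z y2) as (p & q & _ & K)];
  try lra; now apply (differentiable_slices _ _ _ _ _ K).
Qed.

Lemma holo_rect_ex_RInt_y x1 x2 y1 y2 :
  a <= x1 <= b -> a <= x2 <= b -> c <= y1 -> y1 <= y2 -> y2 <= d ->
  ex_RInt (fun t => u x2 t - u x1 t) y1 y2.
Proof.
intros H1 H2 H3 H4 H5.
apply (ex_RInt_continuous (V := R_CompleteNormedModule)). intros z Hz.
rewrite Rmin_left, Rmax_right in Hz by lra.
apply (continuous_minus (V := R_NormedModule));
  [destruct (Huv x2 z) as (p & q & K & _)|destruct (Huv x1 z) as (p & q & K & _)];
  try lra; now apply (differentiable_slices _ _ _ _ _ K).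
Qed.

Lemma rect_int_split_x x1 x2 x3 y1 y2 :
  a <= x1 -> x1 <= x2 -> x2 <= x3 -> x3 <= b -> c <= y1 -> y1 <= y2 -> y2 <= d ->
  rect_int u v x1 x3 y1 y2 = rect_int u v x1 x2 y1 y2 + rect_int u v x2 x3 y1 y2.
Proof.
intros. unfold rect_int.
rewrite (RInt_RChasles (fun s => v s y1 - v s y2) x1 x2 x3)
  by (apply holo_rect_ex_RInt_x; lra).
rewrite (RInt_ext (fun t => u x3 t - u x1 t)
  (fun t => (u x3 t - u x2 t) + (u x2 t - u x1 t)))
  by (intros; simpl; ring).
rewrite RInt_Rplus by (apply holo_rect_ex_RInt_y; lra).
ring.
Qed.

Lemma rect_int_split_y x1 x2 y1 y2 y3 :
  a <= x1 -> x1 <= x2 -> x2 <= b -> c <= y1 -> y1 <= y2 -> y2 <= y3 -> y3 <= d ->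
  rect_int u v x1 x2 y1 y3 = rect_int u v x1 x2 y1 y2 + rect_int u v x1 x2 y2 y3.
Proof.
intros. unfold rect_int.
rewrite (RInt_RChasles (fun t => u x2 t - u x1 t) y1 y2 y3)
  by (apply holo_rect_ex_RInt_y; lra).
rewrite (RInt_ext (fun s => v s y1 - v s y3)
  (fun s => (v s y1 - v s y2) + (v s y2 - v s y3)))
  by (intros; simpl; ring).
rewrite RInt_Rplus by (apply holo_rect_ex_RInt_x; lra).
ring.
Qed.

(** The integral is the sum of those over the four quarters, since inner sides cancel; so some
    quarter carries at least a fourth of its absolute value. *)
Lemma rect_int_quarter x y l m K :
  0 <= l -> 0 <= m -> a <= x -> x + 2 * l <= b -> c <= y -> y + 2 * m <= d ->
  4 * K <= Rabs (rect_int u v x (x + 2 * l) y (y + 2 * m)) ->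
  exists x' y', x <= x' /\ x' + l <= x + 2 * l /\ y <= y' /\ y' + m <= y + 2 * m /\
    K <= Rabs (rect_int u v x' (x' + l) y' (y' + m)).
Proof.
intros Hl Hm Hx1 Hx2 Hy1 Hy2 HK.
rewrite (rect_int_split_x x (x + l)) in HK by lra.
rewrite (rect_int_split_y x (x + l) y (y + m)) in HK by lra.
rewrite (rect_int_split_y (x + l) (x + 2 * l) y (y + m)) in HK by lra.
replace (x + 2 * l) with (x + l + l) in HK by ring.
replace (y + 2 * m) with (y + m + m) in HK by ring.
set (e1 := rect_int u v x (x + l) y (y + m)) in HK.
set (e2 := rect_int u v x (x + l) (y + m) (y + m + m)) in HK.
set (e3 := rect_int u v (x + l) (x + l + l) y (y + m)) in HK.
set (e4 := rect_int u v (x + l) (x + l + l) (y + m) (y + m + m)) in HK.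
destruct (Rle_dec K (Rabs e1)); [exists x, y; repeat split; try lra; assumption|].
destruct (Rle_dec K (Rabs e2)); [exists x, (y + m); repeat split; try lra; assumption|].
destruct (Rle_dec K (Rabs e3)); [exists (x + l), y; repeat split; try lra; assumption|].
destruct (Rle_dec K (Rabs e4)); [exists (x + l), (y + m); repeat split; try lra; assumption|].
exfalso.
pose proof (Rabs_triang (e1 + e2) (e3 + e4)).
pose proof (Rabs_triang e1 e2). pose proof (Rabs_triang e3 e4). lra.
Qed.

(** On a small rectangle [u + iv] is affine up to [eps / 2 * (l + m)]. For the affine part the
    horizontal sides contribute [- p m l] and the vertical sides [p m l], so only the errors
    survive. *)
Lemma rect_int_local x0 y0 eps :
  0 < eps -> a <= x0 <= b -> c <= y0 <= d ->
  exists delta, 0 < delta /\ forall x y l m,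
    0 <= l < delta -> 0 <= m < delta -> a <= x -> x + l <= b -> c <= y -> y + m <= d ->
    x <= x0 <= x + l -> y <= y0 <= y + m ->
    Rabs (rect_int u v x (x + l) y (y + m)) <= eps * (l + m) ^ 2.
Proof.
intros Heps Hx0 Hy0.
destruct (Huv x0 y0 Hx0 Hy0) as (p & q & Hu & Hv).
assert (He2 : 0 < eps / 2) by lra.
destruct (Hu (mkposreal (eps / 2) He2)) as [d1 K1].
destruct (Hv (mkposreal (eps / 2) He2)) as [d2 K2].
exists (Rmin d1 d2). split; [apply Rmin_glb_lt; apply cond_pos|].
intros x y l m Hl Hm Hx1 Hx2 Hy1 Hy2 Hx Hy.
pose proof (Rmin_l d1 d2). pose proof (Rmin_r d1 d2).
assert (near : forall s t, x <= s <= x + l -> y <= t <= y + m ->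
   Rabs (u s t - u x0 y0 - (p * (s - x0) + - q * (t - y0))) <= eps / 2 * (l + m) /\
   Rabs (v s t - v x0 y0 - (q * (s - x0) + p * (t - y0))) <= eps / 2 * (l + m)).
{ intros s t Hs Ht.
  assert (A1 : Rabs (s - x0) <= l) by (apply Rabs_le; lra).
  assert (A2 : Rabs (t - y0) <= m) by (apply Rabs_le; lra).
  assert (A3 : Rmax (Rabs (s - x0)) (Rabs (t - y0)) <= l + m) by (apply Rmax_lub; lra).
  split; [eapply Rle_trans; [apply K1|]|eapply Rle_trans; [apply K2|]]; try lra;
   simpl; apply Rmult_le_compat_l; lra. }
assert (I1 : Rabs (RInt (fun s => v s y - v s (y + m)) x (x + l) + p * m * l)
   <= l * (eps * (l + m))).
{ replace (RInt (fun s => v s y - v s (y + m)) x (x + l) + p * m * l)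
    with (RInt (fun s => (v s y - v s (y + m)) + p * m) x (x + l)).
  2:{ rewrite RInt_Rplus by (apply ex_RInt_const || (apply holo_rect_ex_RInt_x; lra)). rewrite RInt_Rconst. apply Rminus_diag_uniq; ring. }
  replace (l * (eps * (l + m))) with ((x + l - x) * (eps * (l + m))) by ring.
  apply abs_RInt_le_const; [lra| |].
  - apply (ex_RInt_plus (V := R_CompleteNormedModule)); [apply holo_rect_ex_RInt_x; lra|apply ex_RInt_const].
  - intros s Hs.
    destruct (near s y) as [_ N1]; try lra. destruct (near s (y + m)) as [_ N2]; try lra.
    apply Rabs_le_between in N1. apply Rabs_le_between in N2. apply Rabs_le_between. lra. }
assert (I2 : Rabs (RInt (fun t => u (x + l) t - u x t) y (y + m) - p * m * l)
   <= m * (eps * (l + m))).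
{ replace (RInt (fun t => u (x + l) t - u x t) y (y + m) - p * m * l)
    with (RInt (fun t => (u (x + l) t - u x t) + - (p * l)) y (y + m)).
  2:{ rewrite RInt_Rplus by (apply ex_RInt_const || (apply holo_rect_ex_RInt_y; lra)). rewrite RInt_Rconst. apply Rminus_diag_uniq; ring. }
  replace (m * (eps * (l + m))) with ((y + m - y) * (eps * (l + m))) by ring.
  apply abs_RInt_le_const; [lra| |].
  - apply (ex_RInt_plus (V := R_CompleteNormedModule)); [apply holo_rect_ex_RInt_y; lra|apply ex_RInt_const].
  - intros t Ht.
    destruct (near (x + l) t) as [N1 _]; try lra. destruct (near x t) as [N2 _]; try lra.
    apply Rabs_le_between in N1. apply Rabs_le_between in N2. apply Rabs_le_between. lra. }
unfold rect_int.
apply Rabs_le_between in I1. apply Rabs_le_between in I2. apply Rabs_le_between.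
replace (eps * (l + m) ^ 2) with (l * (eps * (l + m)) + m * (eps * (l + m))) by ring. lra.
Qed.

(* Goursat's bisection: if the integral is nonzero, nested quarter rectangles keep
   at least 4^-n of it, contradicting the quadratic bound rect_int_local at their
   common point. *)
Lemma goursat : rect_int u v a b c d = 0.
Proof.
set (E := Rabs (rect_int u v a b c d)).
(* [P] is the lower left corner of the rectangle reached after [n] bisections. *)
set (good := fun (n : nat) (P : R * R) =>
  a <= fst P /\ fst P + (b - a) / 2 ^ n <= b /\
  c <= snd P /\ snd P + (d - c) / 2 ^ n <= d /\
  E / 4 ^ n <= Rabs (rect_int u v (fst P) (fst P + (b - a) / 2 ^ n)
                                  (snd P) (snd P + (d - c) / 2 ^ n))).
set (nested := fun (n : nat) (P Q : R * R) =>
  fst P <= fst Q /\ fst Q + (b - a) / 2 ^ S n <= fst P + (b - a) / 2 ^ n /\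
  snd P <= snd Q /\ snd Q + (d - c) / 2 ^ S n <= snd P + (d - c) / 2 ^ n).
assert (pow2 : forall n, 0 < 2 ^ n) by (intros; apply pow_lt; lra).
assert (pow4 : forall n, 0 < 4 ^ n) by (intros; apply pow_lt; lra).
assert (half : forall n w, w / 2 ^ n = 2 * (w / 2 ^ S n)).
{ intros n w. simpl. field. apply Rgt_not_eq, pow2. }
assert (side : forall n w, 0 <= w -> 0 <= w / 2 ^ n).
{ intros n w Hw. apply Rmult_le_pos; [exact Hw|]. left. apply Rinv_0_lt_compat, pow2. }
(* [choice] needs a successor for every pair [(n, P)], so [good] is a premise inside the
   existential; where it fails, [P] itself serves as a dummy. *)
assert (step : forall nP : nat * (R * R), exists Q,
  good (fst nP) (snd nP) -> good (S (fst nP)) Q /\ nested (fst nP) (snd nP) Q).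
{ intros [n P]. cbn [fst snd].
  destruct (Classical_Prop.classic (good n P)) as [G|G]; [|exists P; intros; now destruct G].
  destruct G as (G1 & G2 & G3 & G4 & G5).
  rewrite (half n (b - a)) in G2, G5. rewrite (half n (d - c)) in G4, G5.
  destruct (rect_int_quarter (fst P) (snd P) ((b - a) / 2 ^ S n) ((d - c) / 2 ^ S n)
    (E / 4 ^ S n)) as (x' & y' & Q1 & Q2 & Q3 & Q4 & Q5); try assumption.
  - apply side; lra.
  - apply side; lra.
  - eapply Rle_trans; [|exact G5]. right. simpl. field. apply Rgt_not_eq, pow4.
  - exists (x', y'). intros _. unfold good, nested. cbn [fst snd].
    rewrite (half n (b - a)), (half n (d - c)). repeat split; lra. }
destruct (choice _ step) as [next Hnext].
set (P := fix P n := match n with O => (a, c) | S k => next (k, P k) end).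
assert (HP : forall n, good n (P n)).
{ induction n as [|n IH].
  - unfold good; simpl. unfold E. rewrite !Rdiv_1_r.
    replace (a + (b - a)) with b by ring. replace (c + (d - c)) with d by ring.
    repeat split; lra.
  - exact (proj1 (Hnext (n, P n) IH)). }
assert (HN : forall n, nested n (P n) (P (S n))) by (intros n; exact (proj2 (Hnext (n, P n) (HP n)))).
(* Nested intervals: the left endpoints increase and stay below every right endpoint, so their
   supremum lies in all the intervals. *)
assert (limit : forall (x : nat -> R) w, 0 <= w ->
   (forall n, x n <= x (S n) /\ x (S n) + w / 2 ^ S n <= x n + w / 2 ^ n) ->
   exists x0, forall n, x n <= x0 <= x n + w / 2 ^ n).
{ intros x w Hw Hx.
  assert (M1 : forall n k, x n <= x (n + k)%nat).
  { intros n k. induction k as [|k IH]; [rewrite Nat.add_0_r; lra|].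
    rewrite Nat.add_succ_r. destruct (Hx (n + k)%nat). lra. }
  assert (M2 : forall n k, x (n + k)%nat + w / 2 ^ (n + k) <= x n + w / 2 ^ n).
  { intros n k. induction k as [|k IH]; [rewrite Nat.add_0_r; lra|].
    rewrite Nat.add_succ_r. destruct (Hx (n + k)%nat). lra. }
  assert (M3 : forall n k, x k <= x n + w / 2 ^ n).
  { intros n k. specialize (M1 k n). specialize (M2 n k).
    rewrite (Nat.add_comm k n) in M1. specialize (side (n + k)%nat w Hw). lra. }
  destruct (completeness (fun r => exists n, r = x n)) as [x0 [U L]].
  - exists (x 0%nat + w / 2 ^ 0). intros r [k ->]. apply M3.
  - now exists (x 0%nat), 0%nat.
  - exists x0. intros n. split; [apply U; now exists n|].
    apply L. intros r [k ->]. apply M3. }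
destruct (limit (fun n => fst (P n)) (b - a)) as [x0 Hx0]; [lra|intros n; destruct (HN n); tauto|].
destruct (limit (fun n => snd (P n)) (d - c)) as [y0 Hy0]; [lra|intros n; destruct (HN n); tauto|].
assert (B0 : a <= x0 <= b).
{ specialize (Hx0 0%nat). simpl in Hx0. rewrite Rdiv_1_r in Hx0. lra. }
assert (B1 : c <= y0 <= d).
{ specialize (Hy0 0%nat). simpl in Hy0. rewrite Rdiv_1_r in Hy0. lra. }
set (W := (b - a) + (d - c)).
(* The lower bound [E / 4 ^ n] and the quadratic upper bound [eps (W / 2 ^ n)^2] shrink at the same
   rate, so [n] drops out. Dividing by [W + 1] allows for a degenerate rectangle with [W = 0]. *)
assert (HE : forall eps, 0 < eps -> E <= eps * W ^ 2).
{ intros eps Heps.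
  destruct (rect_int_local x0 y0 eps Heps B0 B1) as (delta & Hd & K).
  destruct (pow_lt_1_zero (1 / 2) ltac:(rewrite Rabs_pos_eq; lra) (delta / (W + 1))) as [n Hn].
  { apply Rdiv_lt_0_compat; unfold W; lra. }
  specialize (Hn n (le_n n)).
  assert (Hi : (1 / 2) ^ n = / 2 ^ n).
  { unfold Rdiv. rewrite Rmult_1_l. apply pow_inv. }
  rewrite Hi, Rabs_pos_eq in Hn by (left; apply Rinv_0_lt_compat, pow2).
  assert (HW : (W + 1) * / 2 ^ n < delta).
  { apply (Rmult_lt_compat_l (W + 1)) in Hn; [|unfold W; lra].
    replace ((W + 1) * (delta / (W + 1))) with delta in Hn by (field; unfold W; lra). exact Hn. }
  assert (Hip : 0 < / 2 ^ n) by apply Rinv_0_lt_compat, pow2.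
  destruct (HP n) as (G1 & G2 & G3 & G4 & G5).
  specialize (K (fst (P n)) (snd (P n)) ((b - a) / 2 ^ n) ((d - c) / 2 ^ n)).
  assert (E / 4 ^ n <= eps * ((b - a) / 2 ^ n + (d - c) / 2 ^ n) ^ 2).
  { eapply Rle_trans; [exact G5|]. apply K; try assumption; try apply Hx0; try apply Hy0.
    - split; [apply side; lra|]. unfold Rdiv, W in *. nra.
    - split; [apply side; lra|]. unfold Rdiv, W in *. nra. }
  replace (eps * ((b - a) / 2 ^ n + (d - c) / 2 ^ n) ^ 2) with (eps * W ^ 2 / 4 ^ n) in H.
  - apply (Rmult_le_reg_r (/ 4 ^ n)); [apply Rinv_0_lt_compat, pow4|exact H].
  - replace (4 ^ n) with (2 ^ n * 2 ^ n) by (rewrite <- Rpow_mult_distr; f_equal; ring).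
    unfold W. field. apply Rgt_not_eq, pow2. }
assert (HE0 : E <= 0).
{ apply le_epsilon. intros e He.
  assert (0 < W ^ 2 + 1) by (pose proof (pow2_ge_0 W); lra).
  specialize (HE (e / (W ^ 2 + 1)) ltac:(apply Rdiv_lt_0_compat; lra)).
  eapply Rle_trans; [exact HE|].
  apply (Rmult_le_reg_r (W ^ 2 + 1)); [assumption|].
  replace (e / (W ^ 2 + 1) * W ^ 2 * (W ^ 2 + 1)) with (e * W ^ 2) by (field; lra). nra. }
pose proof (Rabs_pos (rect_int u v a b c d)). fold E in H.
destruct (Req_dec (rect_int u v a b c d) 0) as [E0|E0]; [exact E0|].
apply Rabs_no_R0 in E0. fold E in E0. lra.
Qed.

End Rect.

(** * Means over circles *)

Lemma Cmod_circle r t : 0 <= r -> Cmod (r * cos t, r * sin t) = r.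
Proof.
intros Hr. unfold Cmod; simpl fst; simpl snd.
replace ((r * cos t) ^ 2 + (r * sin t) ^ 2) with (r ^ 2); [now apply sqrt_pow2|].
pose proof (sin2_cos2 t) as T. unfold Rsqr in T.
transitivity (r ^ 2 * (sin t * sin t + cos t * cos t)); [rewrite T|]; ring.
Qed.

Lemma differentiable_pt_lim_fst x y : differentiable_pt_lim (fun s _ => s) x y 1 0.
Proof. apply differentiable_pt_lim_proj1_0, derivable_pt_lim_id. Qed.

Lemma differentiable_pt_lim_snd x y : differentiable_pt_lim (fun _ t => t) x y 0 1.
Proof.
intros eps. exists (mkposreal 1 Rlt_0_1). intros s t _ _.
replace (t - y - (0 * (s - x) + 1 * (t - y))) with 0 by ring. rewrite Rabs_R0.
apply Rmult_le_pos; [left; apply cond_pos|].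
eapply Rle_trans; [apply Rabs_pos|apply Rmax_l].
Qed.

Lemma differentiable_pt_lim_Rmult x y : differentiable_pt_lim Rmult x y y x.
Proof.
intros eps. exists eps. intros s t Hs Ht.
replace (s * t - x * y - (y * (s - x) + x * (t - y))) with ((t - y) * (s - x)) by ring.
rewrite Rabs_mult. apply Rmult_le_compat; try apply Rabs_pos; [lra|apply Rmax_l].
Qed.

Lemma differentiable_pt_lim_polar (g : R -> R) (x y l : R) :
  derivable_pt_lim g y l ->
  differentiable_pt_lim (fun s t => exp s * g t) x y (exp x * g y) (exp x * l).
Proof.
intros Hg.
pose proof (differentiable_pt_lim_comp Rmult (fun s _ => exp s) (fun _ t => g t) x y
  _ _ _ _ _ _ (differentiable_pt_lim_Rmult _ _)
  (differentiable_pt_lim_proj1_0 _ x y _ (derivable_pt_lim_exp x))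
  (differentiable_pt_lim_comp (fun t _ => g t) (fun _ t => t) (fun s _ => s) x y
    _ _ _ _ _ _ (differentiable_pt_lim_proj1_0 g y x l Hg)
    (differentiable_pt_lim_snd x y) (differentiable_pt_lim_fst x y))) as H.
replace (exp x * g y) with (g y * exp x + exp x * (l * 0 + 0 * 1)) by ring.
replace (exp x * l) with (g y * 0 + exp x * (l * 1 + 0 * 0)) by ring.
exact H.
Qed.

(** With [z = exp (s + it)], the derivative of [G z] in [s + it] is [z] times the derivative of [G]
    at [z]. The witnesses in the proof are the real and imaginary parts of this product. *)
Lemma holo_rect_polar (G : C -> C) (a b c d : R) :
  (forall s t, a <= s <= b -> exists l, cderiv G (exp s * cos t, exp s * sin t) l) ->
  holo_rect (fun s t => fst (G (exp s * cos t, exp s * sin t)))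
            (fun s t => snd (G (exp s * cos t, exp s * sin t))) a b c d.
Proof.
intros HG s t Hs _. destruct (HG s t Hs) as [[p q] Hl].
destruct (cderiv_re_im _ _ _ _ Hl) as [H1 H2]. simpl in H1, H2.
pose proof (differentiable_pt_lim_polar cos s t _ (derivable_pt_lim_cos t)) as Hc.
pose proof (differentiable_pt_lim_polar sin s t _ (derivable_pt_lim_sin t)) as Hsn.
exists (p * (exp s * cos t) - q * (exp s * sin t)), (q * (exp s * cos t) + p * (exp s * sin t)).
split.
- pose proof (differentiable_pt_lim_comp _ _ _ _ _ _ _ _ _ _ _ H1 Hc Hsn) as K.
  replace (p * (exp s * cos t) - q * (exp s * sin t))
    with (p * (exp s * cos t) + - q * (exp s * sin t)) by ring.
  replace (- (q * (exp s * cos t) + p * (exp s * sin t)))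
    with (p * (exp s * - sin t) + - q * (exp s * cos t)) by ring.
  exact K.
- pose proof (differentiable_pt_lim_comp _ _ _ _ _ _ _ _ _ _ _ H2 Hc Hsn) as K.
  replace (p * (exp s * cos t) - q * (exp s * sin t))
    with (q * (exp s * - sin t) + p * (exp s * cos t)) by ring.
  exact K.
Qed.

Lemma is_RInt_trig (m al be : R) :
  is_RInt (fun t => m + (al * cos t + be * sin t)) 0 (2 * PI) (2 * PI * m).
Proof.
set (P := fun t => m * t + (al * sin t - be * cos t)).
replace (2 * PI * m) with (minus (P (2 * PI)) (P 0)).
2:{ unfold minus, plus, opp; simpl. unfold P. rewrite sin_2PI, cos_2PI, sin_0, cos_0.
    apply Rminus_diag_uniq; ring. }
apply (is_RInt_derive (V := R_CompleteNormedModule)).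
- intros t _. unfold P. auto_derive; [exact I|ring].
- intros t _. apply (ex_derive_continuous (V := R_NormedModule)). auto_derive. exact I.
Qed.

(* The mean of Re G over the circle |z| = r does not depend on r, and linear
   terms have mean zero. *)
Lemma circle_mean_le (G : C -> C) (r1 r2 m M al1 be1 al2 be2 : R) :
  0 < r1 < r2 ->
  (forall z, r1 <= Cmod z <= r2 -> exists l, cderiv G z l) ->
  (forall t, m + (al1 * cos t + be1 * sin t) <= fst (G (r1 * cos t, r1 * sin t))) ->
  (forall t, fst (G (r2 * cos t, r2 * sin t)) <= M + (al2 * cos t + be2 * sin t)) ->
  m <= M.
Proof.
intros Hr HG Hlow Hup.
assert (Hln : ln r1 <= ln r2) by (left; apply ln_increasing; lra).
pose proof PI_RGT_0 as HPI.
set (u := fun s t => fst (G (exp s * cos t, exp s * sin t))).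
set (v := fun s t => snd (G (exp s * cos t, exp s * sin t))).
assert (Huv : holo_rect u v (ln r1) (ln r2) 0 (2 * PI)).
{ apply holo_rect_polar. intros s t Hs. apply HG.
  assert (E : Cmod (exp s * cos t, exp s * sin t) = exp s)
    by (apply Cmod_circle; left; apply exp_pos).
  rewrite E. rewrite <- (exp_ln r1), <- (exp_ln r2) by lra.
  assert (mono : forall x y, x <= y -> exp x <= exp y).
  { intros x y [H| ->]; [left; now apply exp_increasing|right; reflexivity]. }
  split; apply mono; apply Hs. }
assert (H2PI : 0 <= 2 * PI) by lra.
pose proof (goursat u v _ _ _ _ Hln H2PI Huv) as E.
unfold rect_int in E.
(* The sides [t = 0] and [t = 2 * PI] have the same image under the polar map, so their
   contributions cancel. *)
rewrite (RInt_ext _ (fun _ => 0)) in E.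
2:{ intros s _. unfold v. rewrite cos_2PI, sin_2PI, cos_0, sin_0. apply Rminus_diag_eq; reflexivity. }
rewrite RInt_Rconst, Rmult_0_r, Rplus_0_l in E.
pose proof (is_RInt_trig (M - m) (al2 - al1) (be2 - be1)) as I.
(* What Goursat's theorem leaves is the difference of the integrals over the two circles, which is
   zero; the two pointwise bounds estimate it by [2 * PI * (M - m)]. *)
assert (L : RInt (fun t => u (ln r2) t - u (ln r1) t) 0 (2 * PI) <= 2 * PI * (M - m)).
{ rewrite <- (is_RInt_unique _ _ _ _ I). apply RInt_le; [lra| |eexists; exact I|].
  - apply (holo_rect_ex_RInt_y u v (ln r1) (ln r2) 0 (2 * PI)); try assumption; lra.
  - intros t _. unfold u. rewrite !exp_ln by lra.
    specialize (Hlow t). specialize (Hup t). lra. }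
rewrite E in L. nra.
Qed.

(** * A Schwarz lemma for the second coefficient *)

(** This little-o form stands in for a power series: it gives a meaning to the second coefficient of
    a function of which only a first derivative is at hand. *)
Definition expands2 (w : C -> C) (c1 c2 : C) : Prop :=
  forall eps, 0 < eps -> exists d, 0 < d /\ forall z, Cmod z < d ->
    Cmod (w z - c1 * z - c2 * (z * z))%C <= eps * Cmod z ^ 2.

Lemma unimodular_aligning (K : C) : exists lam : C, Cmod lam = 1 /\ (lam * K)%C = RtoC (Cmod K).
Proof.
destruct (Ceq_dec K 0) as [->|HK].
- exists 1%C. rewrite Cmod_1, Cmod_0. split; [reflexivity|ring].
- assert (Hm : 0 < Cmod K) by now apply Cmod_gt_0.
  assert (HmC : RtoC (Cmod K) <> 0%C) by (intros E; apply RtoC_inj in E; lra).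
  exists (Cconj K / RtoC (Cmod K))%C. split.
  + rewrite Cmod_div, Cmod_conj, Cmod_R, Rabs_pos_eq by (assumption || lra). field. lra.
  + replace (Cconj K / RtoC (Cmod K) * K)%C with ((K * Cconj K) / RtoC (Cmod K))%C
      by (unfold Cdiv; ring).
    rewrite <- Cmod2_conj, RtoC_pow. field. exact HmC.
Qed.

Section Schwarz.
Variables (w : C -> C) (c1 c2 : C).
Hypothesis (Hw : forall z, Cmod z < 1 -> Cmod (w z) < 1 /\ exists l, cderiv w z l).
Hypothesis (Hexp : expands2 w c1 c2).

(** The means of [Re G] over the circles of radius [r1] and [r] are compared. On the small circle
    [G] equals [|K| + lam c1 / z] up to [eps]; on the large one [Re G <= |1 + eta z|^2 / r^2], whose
    mean is the right-hand side. *)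
Lemma schwarz_kernel_eps (eta : C) (r eps : R) : 0 < r < 1 -> 0 < eps ->
  Cmod (c2 + 2 * eta * c1)%C - eps <= (1 + Cmod eta ^ 2 * r ^ 2) / r ^ 2.
Proof.
intros Hr Heps.
set (K := (c2 + 2 * eta * c1)%C).
destruct (unimodular_aligning K) as (lam & Hlam & HlamK).
set (G := fun z : C => (lam * w z * ((1 + eta * z) * (1 + eta * z)) * / (z * z))%C).
set (N := 1 + Cmod eta).
assert (HN : 1 <= N) by (unfold N; pose proof (Cmod_ge_0 eta); lra).
set (S := Cmod (c1 * (eta * eta) + 2 * c2 * eta)%C + Cmod (c2 * (eta * eta))%C).
assert (HS : 0 <= S) by (unfold S; apply Rplus_le_le_0_compat; apply Cmod_ge_0).
(* [N] bounds [|1 + eta z|] on the disk, so the remainder of [w] costs at most [eps / 2]. The other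
   half pays for the terms of higher order, bounded by [r1 * S]. *)
destruct (Hexp (eps / (2 * N ^ 2))) as (d & Hd & Kd).
{ apply Rdiv_lt_0_compat; [lra|]. nra. }
set (r1 := Rmin (r / 2) (Rmin (d / 2) (eps / (2 * (S + 1))))).
assert (Hr1 : 0 < r1 /\ r1 <= r / 2 /\ r1 <= d / 2 /\ r1 <= eps / (2 * (S + 1))).
{ assert (0 < eps / (2 * (S + 1))) by (apply Rdiv_lt_0_compat; lra).
  unfold r1. repeat split.
  - repeat apply Rmin_glb_lt; lra.
  - apply Rmin_l.
  - eapply Rle_trans; [apply Rmin_r|apply Rmin_l].
  - eapply Rle_trans; [apply Rmin_r|apply Rmin_r]. }
destruct Hr1 as (Hr1 & Hr1r & Hr1d & Hr1e).
assert (Hr1e' : r1 * S <= eps / 2).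
{ apply Rle_trans with (eps / (2 * (S + 1)) * (S + 1)).
  - apply Rmult_le_compat; lra.
  - right. field. lra. }
(* The trigonometric coefficients are those of [Re (lam c1 / z)] on the circle of radius [r1] and of
   [2 Re (eta z) / r^2] on that of radius [r]. *)
apply (circle_mean_le G r1 r _ _
  (fst (lam * c1)%C / r1) (snd (lam * c1)%C / r1)
  (2 * fst eta / r) (- 2 * snd eta / r)); [lra| | |].
- intros z Hz. assert (Hz0 : z <> 0) by (apply Cmod_gt_0; lra).
  destruct (Hw z) as [_ [l Hl]]; [lra|].
  assert (Hlin : cderiv (fun z => 1 + eta * z)%C z (0 + (0 * z + eta * 1))%C).
  { apply cderiv_plus; [apply cderiv_const|].
    apply cderiv_mult; [apply cderiv_const|apply cderiv_id]. }
  eexists. unfold G. apply cderiv_mult.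
  + apply cderiv_mult; [apply cderiv_mult; [apply cderiv_const|exact Hl]|].
    apply cderiv_mult; exact Hlin.
  + apply (cderiv_inv (fun z => (z * z)%C)).
    * now apply Cmult_neq_0.
    * apply cderiv_mult; apply cderiv_id.
- intros t. set (z := (r1 * cos t, r1 * sin t) : C).
  assert (Ez : Cmod z = r1) by (apply Cmod_circle; lra).
  assert (Hz0 : z <> 0) by (apply Cmod_gt_0; lra).
  set (X := (w z - c1 * z - c2 * (z * z))%C).
  (* [z^3 Y] collects the terms of degree at least three in [(c1 z + c2 z^2) (1 + eta z)^2]; the
     coefficient of [z^2] is [K]. *)
  set (Y := (c1 * (eta * eta) + 2 * c2 * eta + c2 * (eta * eta) * z)%C).
  assert (ED : (G z - RtoC (Cmod K) - lam * c1 * / z)%C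
    = (lam * (X * ((1 + eta * z) * (1 + eta * z)) + z * z * (z * Y)) * / (z * z))%C).
  { rewrite <- HlamK. unfold G, K, X, Y. field. exact Hz0. }
  assert (HX : Cmod X <= eps / (2 * N ^ 2) * r1 ^ 2).
  { rewrite <- Ez at 1. apply Kd. lra. }
  assert (H1 : Cmod (1 + eta * z)%C <= N).
  { eapply Rle_trans; [apply Cmod_triangle|]. rewrite Cmod_1, Cmod_mult, Ez. unfold N.
    pose proof (Cmod_ge_0 eta). nra. }
  assert (HY : Cmod Y <= S).
  { unfold Y, S. eapply Rle_trans; [apply Cmod_triangle|].
    rewrite (Cmod_mult (c2 * (eta * eta)) z), Ez.
    pose proof (Cmod_ge_0 (c2 * (eta * eta))%C). nra. }
  assert (HD : Cmod (G z - RtoC (Cmod K) - lam * c1 * / z)%C <= eps).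
  { rewrite ED, !Cmod_mult, Hlam, Cmod_inv, Cmod_mult, Ez
      by (apply Cmult_neq_0; assumption).
    apply (Rmult_le_reg_r (r1 * r1)); [nra|].
    rewrite Rmult_assoc, Rinv_l, Rmult_1_r, Rmult_1_l by nra.
    eapply Rle_trans; [apply Cmod_triangle|]. rewrite !Cmod_mult, Ez.
    replace (eps * (r1 * r1)) with
      (eps / (2 * N ^ 2) * r1 ^ 2 * (N * N) + r1 * r1 * (eps / 2)) by (field; lra).
    apply Rplus_le_compat.
    - apply Rmult_le_compat; try apply Cmod_ge_0; [|exact HX|].
      + apply Rmult_le_pos; apply Cmod_ge_0.
      + apply Rmult_le_compat; try apply Cmod_ge_0; assumption.
    - apply Rmult_le_compat_l; [nra|]. eapply Rle_trans; [|exact Hr1e'].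
      apply Rmult_le_compat_l; lra. }
  assert (Hre : Rabs (fst (G z - RtoC (Cmod K) - lam * c1 * / z)%C) <= eps).
  { eapply Rle_trans; [apply (re_le_Cmod (G z - RtoC (Cmod K) - lam * c1 * / z)%C)|exact HD]. }
  assert (Einv : fst (lam * c1 * / z)%C
    = fst (lam * c1)%C / r1 * cos t + snd (lam * c1)%C / r1 * sin t).
  { assert (Es : fst z ^ 2 + snd z ^ 2 = r1 ^ 2).
    { rewrite <- Ez. symmetry. apply Cmod2_alt. }
    generalize (lam * c1)%C. intros [A B].
    change (fst ((A, B) * / z)%C) with
      (A * (fst z / (fst z ^ 2 + snd z ^ 2)) - B * (- snd z / (fst z ^ 2 + snd z ^ 2))).
    rewrite Es. simpl. field. lra. }
  change (fst (G z - RtoC (Cmod K) - lam * c1 * / z)%C)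
    with (fst (G z) + - Cmod K + - fst (lam * c1 * / z)%C) in Hre.
  rewrite Einv in Hre. apply Rabs_le_between in Hre. fold K z. lra.
- intros t. set (z := (r * cos t, r * sin t) : C).
  assert (Ez : Cmod z = r) by (apply Cmod_circle; lra).
  assert (Hz0 : z <> 0) by (apply Cmod_gt_0; lra).
  destruct (Hw z) as [Hwz _]; [lra|].
  assert (HG : fst (G z) <= Cmod (1 + eta * z)%C ^ 2 / r ^ 2).
  { eapply Rle_trans; [apply Rle_abs|].
    eapply Rle_trans; [apply (re_le_Cmod (G z))|].
    unfold G. rewrite !Cmod_mult, Hlam, Cmod_inv, Cmod_mult, Ez
      by (apply Cmult_neq_0; assumption).
    pose proof (Cmod_ge_0 (1 + eta * z)%C). pose proof (Cmod_ge_0 (w z)).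
    replace (/ (r * r)) with (/ r ^ 2) by (f_equal; ring).
    apply Rmult_le_compat_r; [left; apply Rinv_0_lt_compat; nra|].
    rewrite Rmult_1_l. nra. }
  eapply Rle_trans; [exact HG|]. right.
  rewrite !Cmod2_alt.
  pose proof (sin2_cos2 t) as T. unfold Rsqr in T.
  unfold Re, Im.
  replace (fst (1 + eta * z)%C) with (1 + (fst eta * (r * cos t) - snd eta * (r * sin t)))
    by (unfold z; simpl; ring).
  replace (snd (1 + eta * z)%C) with (fst eta * (r * sin t) + snd eta * (r * cos t))
    by (unfold z; simpl; ring).
  apply (Rmult_eq_reg_r (r ^ 2)); [|apply pow_nonzero; lra].
  transitivity (1 + (fst eta ^ 2 + snd eta ^ 2) * r ^ 2 * (sin t * sin t + cos t * cos t)
    + 2 * r * (fst eta * cos t - snd eta * sin t)).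
  + field. lra.
  + rewrite T. field. lra.
Qed.

(** The previous bound passes to the limit, first [eps] to 0 and then [r] to 1; the second limit is
    replaced by one radius that contradicts a failure. *)
Lemma schwarz_kernel (eta : C) : Cmod (c2 + 2 * eta * c1)%C <= 1 + Cmod eta ^ 2.
Proof.
destruct (Rle_dec (Cmod (c2 + 2 * eta * c1)%C) (1 + Cmod eta ^ 2)) as [H|H]; [exact H|exfalso].
set (X := Cmod (c2 + 2 * eta * c1)%C - Cmod eta ^ 2).
assert (HX : 1 < X) by (unfold X; lra).
set (y := / X).
assert (Hy : 0 < y /\ y * X = 1).
{ unfold y. split; [apply Rinv_0_lt_compat; lra|apply Rinv_l; lra]. }
assert (Hy1 : y < 1) by nra.
(* With this choice [r^2 - y] is the square of [(1 - y) / 2], so [r^2 > 1 / X], against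
   [X * r^2 <= 1]. *)
set (r := (1 + y) / 2).
assert (Hr : 0 < r < 1) by (unfold r; lra).
assert (L : X * r ^ 2 <= 1).
{ assert (L : X <= 1 / r ^ 2).
  { apply le_epsilon. intros e He.
    pose proof (schwarz_kernel_eps eta r e Hr He) as L.
    replace ((1 + Cmod eta ^ 2 * r ^ 2) / r ^ 2) with (1 / r ^ 2 + Cmod eta ^ 2) in L
      by (field; lra).
    unfold X. lra. }
  apply (Rmult_le_compat_r (r ^ 2)) in L; [|nra].
  replace (1 / r ^ 2 * r ^ 2) with 1 in L by (field; lra). exact L. }
assert (0 < r ^ 2 - y).
{ replace (r ^ 2 - y) with (((1 - y) / 2) ^ 2) by (unfold r; field). nra. }
nra.
Qed.

(** For an aligned [eta] with [|eta| = |c1|], the kernel inequality reads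
    [|c2| + 2 |c1|^2 <= 1 + |c1|^2]. *)
Lemma schwarz_second_coefficient : Cmod c2 + Cmod c1 ^ 2 <= 1.
Proof.
destruct (unimodular_aligning c2) as (lam & Hlam & H2).
(* eta is chosen so that 2 eta c1 points in the direction of c2 *)
pose proof (schwarz_kernel (Cconj lam * Cconj c1)%C) as H.
rewrite Cmod_mult, !Cmod_conj, Hlam in H.
assert (E : (lam * (c2 + 2 * (Cconj lam * Cconj c1) * c1))%C
  = RtoC (Cmod c2 + 2 * Cmod c1 ^ 2)).
{ transitivity (lam * c2 + 2 * (lam * Cconj lam) * (c1 * Cconj c1))%C; [ring|].
  rewrite <- !Cmod2_conj, H2, Hlam, RtoC_plus, RtoC_mult, pow1. ring. }
apply (f_equal Cmod) in E. rewrite Cmod_mult, Hlam, Rmult_1_l, Cmod_R in E.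
pose proof (Cmod_ge_0 c2). pose proof (pow2_ge_0 (Cmod c1)).
rewrite Rabs_pos_eq in E by lra. lra.
Qed.

End Schwarz.

(** * Second-order expansions *)

Lemma Cmod_sub_zero (z : C) : Cmod (z - 0)%C = Cmod z.
Proof. f_equal. ring. Qed.

(** The real mean value theorem is applied to the real part of [Q (t z)] times the conjugate of
    [Q z]. This function of [t] runs from 0 to [|Q z|^2], and one factor [|Q z|] is then
    cancelled. *)
Lemma Cmod_mean_value (Q Q' : C -> C) (r M : R) (z : C) :
  (forall u, Cmod u < r -> cderiv Q u (Q' u)) -> Q 0 = 0 ->
  (forall u, Cmod u <= Cmod z -> Cmod (Q' u) <= M) -> Cmod z < r ->
  Cmod (Q z) <= M * Cmod z.
Proof.
intros HQ HQ0 HM Hz.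
set (k := Cconj (Q z)).
set (seg := fun t : R => (t * fst z, t * snd z) : C).
assert (Hk : Cmod k = Cmod (Q z)) by apply Cmod_conj.
assert (Hseg : forall t, 0 <= t <= 1 -> Cmod (seg t) <= Cmod z).
{ intros t Ht. replace (seg t) with (RtoC t * z)%C
    by (unfold seg, Cmult; simpl; f_equal; ring).
  rewrite Cmod_mult, Cmod_R, Rabs_pos_eq by lra. pose proof (Cmod_ge_0 z). nra. }
set (g := fun t => fst (k * Q (seg t))%C).
set (g' := fun t => fst (k * Q' (seg t) * z)%C).
destruct (MVT_cor2 g g' 0 1) as (t & Et & Ht); [lra| |].
- intros t Ht.
  assert (Hd : cderiv (fun u => k * Q u)%C (seg t)
     (0 * Q (seg t) + k * Q' (seg t))%C).
  { apply cderiv_mult; [apply cderiv_const|]. apply HQ.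
    eapply Rle_lt_trans; [now apply Hseg|exact Hz]. }
  replace (0 * Q (seg t) + k * Q' (seg t))%C
    with (k * Q' (seg t))%C in Hd by ring.
  destruct (cderiv_re_im _ _ _ _ Hd) as [H1 _].
  assert (Hl : forall a, derivable_pt_lim (fun t => t * a) t a).
  { intros a. apply is_derive_Reals. auto_derive; [exact I|ring]. }
  assert (E : g' t = fst (k * Q' (seg t))%C * fst z + - snd (k * Q' (seg t))%C * snd z).
  { unfold g'. generalize (k * Q' (seg t))%C. intros [x y]. simpl. ring. }
  rewrite E. exact (derivable_pt_lim_comp_2d _ _ _ _ _ _ _ _ H1 (Hl (fst z)) (Hl (snd z))).
- assert (E1 : g 1 = Cmod (Q z) ^ 2).
  { unfold g, seg. rewrite !Rmult_1_l, <- surjective_pairing.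
    unfold k. rewrite Cmult_comm, <- Cmod2_conj. reflexivity. }
  assert (E0 : g 0 = 0).
  { unfold g, seg. rewrite !Rmult_0_l. change (0, 0) with (RtoC 0). rewrite HQ0. simpl. ring. }
  rewrite E1, E0 in Et.
  assert (L : g' t <= Cmod (Q z) * (M * Cmod z)).
  { unfold g'. eapply Rle_trans; [apply Rle_abs|].
    eapply Rle_trans; [apply (re_le_Cmod (k * Q' (seg t) * z)%C)|].
    rewrite !Cmod_mult, Hk, Rmult_assoc.
    apply Rmult_le_compat_l; [apply Cmod_ge_0|].
    apply Rmult_le_compat_r; [apply Cmod_ge_0|]. apply HM, Hseg. lra. }
  destruct (Cmod_ge_0 (Q z)) as [P|P].
  + apply (Rmult_le_reg_l (Cmod (Q z))); [exact P|]. nra.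
  + rewrite <- P. apply Rmult_le_pos; [|apply Cmod_ge_0].
    eapply Rle_trans; [apply Cmod_ge_0|apply (HM z); lra].
Qed.

(** The difference [Q] between [phi] and its quadratic Taylor polynomial has derivative
    [phi' u - phi' 0 - b2 u], which is [o(u)]; the mean value inequality gains the missing order. *)
Lemma taylor2 (phi phi' : C -> C) (b2 : C) (r : R) : 0 < r ->
  (forall z, Cmod z < r -> cderiv phi z (phi' z)) -> cderiv phi' 0 b2 ->
  expands2 (fun z => phi z - phi 0)%C (phi' 0) (b2 / 2).
Proof.
intros Hr Hphi Hphi' eps Heps.
destruct (proj1 (cderiv_eps _ _ _) Hphi' eps Heps) as (d & Hd & K).
exists (Rmin r d). split; [now apply Rmin_glb_lt|]. intros z Hz.
set (Q := fun u : C => (phi u + - phi 0 + - (phi' 0 * u) + - (b2 / 2 * (u * u)))%C).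
replace (phi z - phi 0 - phi' 0 * z - b2 / 2 * (z * z))%C with (Q z) by (unfold Q; ring).
replace (eps * Cmod z ^ 2) with (eps * Cmod z * Cmod z) by ring.
pose proof (Rmin_l r d). pose proof (Rmin_r r d).
apply (Cmod_mean_value Q (fun u => phi' u - phi' 0 - b2 * u)%C r).
- intros u Hu.
  replace (phi' u - phi' 0 - b2 * u)%C with
    (phi' u + - 0 + - (0 * u + phi' 0 * 1) + - (0 * (u * u) + b2 / 2 * (1 * u + u * 1)))%C
    by (field).
  unfold Q. repeat apply cderiv_plus; try apply cderiv_opp.
  + now apply Hphi.
  + apply cderiv_const.
  + apply (cderiv_mult (fun _ => phi' 0) (fun u => u)); [apply cderiv_const|apply cderiv_id].
  + apply (cderiv_mult (fun _ => b2 / 2)%C (fun u => u * u)%C); [apply cderiv_const|].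
    apply (cderiv_mult (fun u => u) (fun u => u)); apply cderiv_id.
- unfold Q. ring.
- intros u Hu. specialize (K u ltac:(lra)). rewrite Cplus_0_l in K.
  eapply Rle_trans; [exact K|]. apply Rmult_le_compat_l; lra.
- lra.
Qed.

Section Lift.
Variables (phi w q : C -> C) (b1 b2 c1 k : C) (r : R).
Hypothesis (Hr : 0 < r) (Hb1 : b1 <> 0).
Hypothesis (Hphi : cderiv phi 0 b1) (Hphi2 : expands2 (fun z => phi z - phi 0)%C b1 b2).
Hypothesis (Hphi0 : phi 0 = 1) (Hw0 : w 0 = 0) (Hw : cderiv w 0 c1) (Hq : cderiv q 0 k).
Hypothesis (Heq : forall z, Cmod z < r -> phi (w z) = (1 + z * q z)%C).

(** Both sides of [phi (w z) = 1 + z q z] are differentiated at 0. *)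
Lemma lift_first_coefficient : (b1 * c1)%C = q 0.
Proof.
apply (cderiv_unique (fun z => phi (w z)) 0).
- replace (b1 * c1)%C with (c1 * b1)%C by ring.
  apply (cderiv_comp phi w); [rewrite Hw0; exact Hphi|exact Hw].
- apply (cderiv_ext_near (fun z => 1 + z * q z)%C _ 0 _ r Hr).
  + intros z Hz. rewrite Cmod_sub_zero in Hz. symmetry. now apply Heq.
  + replace (q 0) with (0 + (1 * q 0 + 0 * k))%C by ring.
    apply cderiv_plus; [apply cderiv_const|].
    apply (cderiv_mult (fun z => z) q); [apply cderiv_id|exact Hq].
Qed.

(** The equation is solved for the linear term, [b1 w = z q - b2 w^2 + o(w^2)]. First-order
    knowledge of [q] and of [w] on the right then yields [w] to second order. *)
Lemma lift_expands2 : expands2 w c1 ((k - b2 * (c1 * c1)) / b1)%C.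
Proof.
intros eps Heps.
assert (Hb1m : 0 < Cmod b1) by now apply Cmod_gt_0.
(* [L] bounds [|w z| / |z|] near 0 as soon as [e <= 1]. The three summands of [T] account for the
   remainder of [q], that of [phi], and the replacement of [w^2] by [c1^2 z^2]. *)
set (L := Cmod c1 + 1).
assert (HL : 1 <= L) by (unfold L; pose proof (Cmod_ge_0 c1); lra).
set (T := 1 + L ^ 2 + Cmod b2 * (2 * L)).
assert (HT : 0 < T).
{ unfold T. pose proof (Cmod_ge_0 b2). nra. }
set (e := Rmin 1 (eps * Cmod b1 / T)).
assert (He : 0 < e).
{ unfold e. apply Rmin_glb_lt; [lra|]. apply Rdiv_lt_0_compat; [|exact HT]. nra. }
assert (He1 : e <= 1) by apply Rmin_l.
assert (HeT : e * T <= eps * Cmod b1).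
{ apply Rle_trans with (eps * Cmod b1 / T * T); [|right; field; lra].
  apply Rmult_le_compat_r; [lra|apply Rmin_r]. }
destruct (Hphi2 e He) as (d1 & Hd1 & K1).
destruct (proj1 (cderiv_eps _ _ _) Hw e He) as (d2 & Hd2 & K2).
destruct (proj1 (cderiv_eps _ _ _) Hq e He) as (d3 & Hd3 & K3).
exists (Rmin (Rmin (d1 / L) d2) (Rmin d3 r)). split.
{ repeat apply Rmin_glb_lt; try assumption. apply Rdiv_lt_0_compat; lra. }
intros z Hz.
pose proof (Rmin_l (Rmin (d1 / L) d2) (Rmin d3 r)).
pose proof (Rmin_r (Rmin (d1 / L) d2) (Rmin d3 r)).
pose proof (Rmin_l (d1 / L) d2). pose proof (Rmin_r (d1 / L) d2).
pose proof (Rmin_l d3 r). pose proof (Rmin_r d3 r).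
specialize (K2 z ltac:(lra)). specialize (K3 z ltac:(lra)).
pose proof (Heq z ltac:(lra)) as Hz'.
rewrite Cplus_0_l in K2, K3. rewrite Hw0 in K2.
replace (w z - 0 - c1 * z)%C with (w z - c1 * z)%C in K2 by ring.
set (m := Cmod z) in *.
assert (Hm : 0 <= m) by apply Cmod_ge_0.
assert (Hwz : Cmod (w z) <= L * m).
{ replace (w z) with (w z - c1 * z + c1 * z)%C by ring.
  eapply Rle_trans; [apply Cmod_triangle|]. rewrite (Cmod_mult c1 z). fold m. unfold L. nra. }
assert (HwzP : Cmod (w z + c1 * z)%C <= 2 * L * m).
{ eapply Rle_trans; [apply Cmod_triangle|]. rewrite (Cmod_mult c1 z). fold m. unfold L in *. nra. }
assert (HdL : L * m < d1).
{ apply Rlt_le_trans with (L * (d1 / L)); [apply Rmult_lt_compat_l; lra|right; field; lra]. }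
specialize (K1 (w z) ltac:(lra)).
rewrite Hz', Hphi0 in K1.
set (A := (1 + z * q z - 1 - b1 * w z - b2 * (w z * w z))%C) in *.
set (B := (q z - q 0 - k * z)%C) in *.
assert (E : (w z - c1 * z - (k - b2 * (c1 * c1)) / b1 * (z * z))%C
  = ((z * B + - A + - (b2 * ((w z - c1 * z) * (w z + c1 * z)))) * / b1)%C).
{ unfold A, B. rewrite <- lift_first_coefficient. field. exact Hb1. }
rewrite E, Cmod_mult, Cmod_inv by exact Hb1.
apply (Rmult_le_reg_r (Cmod b1)); [exact Hb1m|].
rewrite Rmult_assoc, Rinv_l, Rmult_1_r by lra.
apply Rle_trans with (e * T * m ^ 2).
2:{ replace (eps * m ^ 2 * Cmod b1) with (eps * Cmod b1 * m ^ 2) by ring.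
    apply Rmult_le_compat_r; [apply pow2_ge_0|exact HeT]. }
eapply Rle_trans; [apply Cmod_triangle|]. rewrite Cmod_opp.
eapply Rle_trans; [apply Rplus_le_compat_r, Cmod_triangle|]. rewrite Cmod_opp.
rewrite !Cmod_mult. fold m.
assert (T1 : m * Cmod B <= e * m ^ 2).
{ replace (e * m ^ 2) with (m * (e * m)) by ring. now apply Rmult_le_compat_l. }
assert (T2 : Cmod A <= e * (L ^ 2 * m ^ 2)).
{ eapply Rle_trans; [exact K1|]. apply Rmult_le_compat_l; [lra|].
  replace (L ^ 2 * m ^ 2) with ((L * m) ^ 2) by ring.
  apply pow_incr. split; [apply Cmod_ge_0|exact Hwz]. }
assert (T3 : Cmod b2 * (Cmod (w z - c1 * z)%C * Cmod (w z + c1 * z)%C)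
   <= Cmod b2 * (e * m * (2 * L * m))).
{ apply Rmult_le_compat_l; [apply Cmod_ge_0|].
  apply Rmult_le_compat; try apply Cmod_ge_0; assumption. }
apply Rle_trans with (e * m ^ 2 + e * (L ^ 2 * m ^ 2) + Cmod b2 * (e * m * (2 * L * m))); [lra|].
right. unfold T. ring.
Qed.

End Lift.

(** * Coefficients of the inverse and the bounds *)

(** Here [q] plays the role of [g'' / g'], with first Taylor coefficients [q 0] and [k]. The
    equation for [c2] holds by the choice of [c2]; the content is that this number is the second
    coefficient of the Schwarz function [w]. *)
Lemma subordinate_coefficients (phi phi' w q : C -> C) (b1 b2 k : C) :
  b1 <> 0 ->
  (forall z, Cmod z < 1 -> cderiv phi z (phi' z)) -> cderiv phi' 0 (2 * b2)%C ->
  phi 0 = 1 -> phi' 0 = b1 ->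
  (forall z, Cmod z < 1 -> Cmod (w z) < 1 /\ exists l, cderiv w z l) -> w 0 = 0 ->
  cderiv q 0 k ->
  (forall z, Cmod z < 1 -> phi (w z) = (1 + z * q z)%C) ->
  exists c1 c2, (b1 * c1)%C = q 0 /\ (b1 * c2 + b2 * (c1 * c1))%C = k /\
    Cmod c2 + Cmod c1 ^ 2 <= 1.
Proof.
intros Hb1 Hphi Hphi' Hphi0 Hphi'0 Hw Hw0 Hq Heq.
assert (D0 : Cmod 0 < 1) by (rewrite Cmod_0; lra).
destruct (Hw 0 D0) as [_ [c1 Hc1]].
pose proof (Hphi 0 D0) as Hd. rewrite Hphi'0 in Hd.
pose proof (taylor2 phi phi' _ 1 Rlt_0_1 Hphi Hphi') as Ht. rewrite Hphi'0 in Ht.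
replace (2 * b2 / 2)%C with b2 in Ht by field.
exists c1, ((k - b2 * (c1 * c1)) / b1)%C. repeat split.
- exact (lift_first_coefficient phi w q b1 c1 k 1 Rlt_0_1 Hd Hw0 Hc1 Hq Heq).
- field. exact Hb1.
- apply (schwarz_second_coefficient w); [exact Hw|].
  exact (lift_expands2 phi w q b1 b2 c1 k 1 Rlt_0_1 Hb1 Hd Ht Hphi0 Hw0 Hc1 Hq Heq).
Qed.

Section Inverse.
Variables (f f' f'' F F' F'' : C -> C) (f3 : C) (r : R).
Hypothesis (Hf : forall z, Cmod z < 1 -> cderiv f z (f' z)).
Hypothesis (Hf' : forall z, Cmod z < 1 -> cderiv f' z (f'' z)).
Hypothesis (Hf'' : cderiv f'' 0 f3).
Hypothesis (HF : forall z, Cmod z < 1 -> cderiv F z (F' z)).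
Hypothesis (HF' : forall z, Cmod z < 1 -> cderiv F' z (F'' z)).
Hypothesis (Hr : 0 < r <= 1).
Hypothesis (Hinv : forall w, Cmod w < r -> Cmod (F w) < 1 /\ f (F w) = w).

Lemma Cmod_lt_near (z w : C) : Cmod (w - z)%C < r - Cmod z -> Cmod w < r.
Proof.
intros H. replace w with (w - z + z)%C by ring.
eapply Rle_lt_trans; [apply Cmod_triangle|lra].
Qed.

Lemma inverse_derivative w : Cmod w < r -> (F' w * f' (F w))%C = 1.
Proof.
intros Hw. apply (cderiv_unique (fun w => f (F w)) w).
- apply (cderiv_comp f F); [apply Hf, (Hinv w Hw)|apply HF; lra].
- apply (cderiv_ext_near (fun w => w) _ w 1 (r - Cmod w)); [lra| |apply cderiv_id].
  intros u Hu. symmetry. apply Hinv. now apply (Cmod_lt_near w).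
Qed.

Lemma inverse_second_derivative w : Cmod w < r ->
  (F'' w * f' (F w) + F' w * (F' w * f'' (F w)))%C = 0.
Proof.
intros Hw. apply (cderiv_unique (fun w => F' w * f' (F w))%C w).
- apply (cderiv_mult F' (fun w => f' (F w))); [apply HF'; lra|].
  apply (cderiv_comp f' F); [apply Hf', (Hinv w Hw)|apply HF; lra].
- apply (cderiv_ext_near (fun _ => 1%C) _ w 0 (r - Cmod w)); [lra| |apply cderiv_const].
  intros u Hu. symmetry. apply inverse_derivative. now apply (Cmod_lt_near w).
Qed.

(** Differentiating [f (F w) = w] twice expresses [F''] through [F'] and [f'']. The right-hand side
    can be differentiated at 0 without a third derivative of [F]. *)
Lemma inverse_log_derivative w : Cmod w < r ->
  (F'' w / F' w)%C = (- (f'' (F w) * (F' w * F' w)))%C.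
Proof.
intros Hw. pose proof (inverse_derivative w Hw) as E1.
pose proof (inverse_second_derivative w Hw) as E2.
assert (HF0 : F' w <> 0).
{ intros E. rewrite E, Cmult_0_l in E1. symmetry in E1. now apply C1_nz in E1. }
assert (E3 : F'' w = (- (f'' (F w) * (F' w * F' w)) * F' w)%C).
{ transitivity (F'' w * (F' w * f' (F w)))%C; [rewrite E1; ring|].
  transitivity (F' w * (F'' w * f' (F w) + F' w * (F' w * f'' (F w)))
     - F' w * (F' w * (F' w * f'' (F w))))%C; [ring|].
  rewrite E2. ring. }
rewrite E3. field. exact HF0.
Qed.

(** With [f'' 0 = 2 a2] and [f3 = 6 a3] these two values are [- 2 a2] and [8 a2^2 - 6 a3]. *)
Lemma cderiv_inverse_log_derivative : f' 0 = 1 -> F 0 = 0 ->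
  (F'' 0 / F' 0)%C = (- f'' 0)%C /\
  cderiv (fun w => F'' w / F' w)%C 0 (2 * (f'' 0 * f'' 0) - f3)%C.
Proof.
intros Hf'0 HF0.
assert (D0 : Cmod 0 < r) by (rewrite Cmod_0; lra).
pose proof (inverse_derivative 0 D0) as E1. rewrite HF0, Hf'0, Cmult_1_r in E1.
pose proof (inverse_second_derivative 0 D0) as E2. rewrite HF0, Hf'0, E1 in E2.
assert (E3 : F'' 0 = (- f'' 0)%C).
{ transitivity (F'' 0 * 1 + 1 * (1 * f'' 0) - f'' 0)%C; [ring|rewrite E2; ring]. }
split; [rewrite E1, E3; field; apply C1_nz|].
apply (cderiv_ext_near (fun w => - (f'' (F w) * (F' w * F' w)))%C _ 0 _ r); [lra| |].
- intros w Hw. rewrite Cmod_sub_zero in Hw. symmetry. now apply inverse_log_derivative.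
- assert (D1 : Cmod 0 < 1) by lra.
  replace (2 * (f'' 0 * f'' 0) - f3)%C with
    (- (F' 0 * f3 * (F' 0 * F' 0) + f'' (F 0) * (F'' 0 * F' 0 + F' 0 * F'' 0)))%C
    by (rewrite HF0, E1, E3; ring).
  apply cderiv_opp, (cderiv_mult (fun w => f'' (F w)) (fun w => F' w * F' w)%C).
  + apply (cderiv_comp f'' F); [rewrite HF0; exact Hf''|now apply HF].
  + apply cderiv_mult; now apply HF'.
Qed.

End Inverse.

Lemma RtoC_scal_Cmod (x : R) (z : C) : 0 <= x -> Cmod (x * z)%C = x * Cmod z.
Proof. intros H. rewrite Cmod_mult, Cmod_R, Rabs_pos_eq; auto. Qed.

Section Bounds.
Variables (B1 B2 : R) (a2 a3 c1 c2 d1 d2 : C).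
Hypothesis (HB1 : 0 < B1).
Hypothesis (Hc : Cmod c2 + Cmod c1 ^ 2 <= 1) (Hd : Cmod d2 + Cmod d1 ^ 2 <= 1).
Hypothesis (Hc1 : (B1 * c1)%C = (2 * a2)%C) (Hd1 : (B1 * d1)%C = (- (2 * a2))%C).
Hypothesis (Hc2 : (B1 * c2 + B2 * (c1 * c1))%C = (6 * a3 - 4 * (a2 * a2))%C).
Hypothesis (Hd2 : (B1 * d2 + B2 * (d1 * d1))%C = (8 * (a2 * a2) - 6 * a3)%C).

(** Since [d1 = - c1], the [B2] terms of the two second-order equations coincide: they double in the
    sum and cancel in the difference. The Schwarz inequalities turn everything into estimates in
    [t = |c1|^2]. *)
Lemma coefficient_bounds :
  (Cmod a2 <= B1 / 2 /\ Cmod a2 ^ 2 <= (B1 ^ 2 + B1 + Rabs (B2 - B1)) / 6) /\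
  (Cmod a3 <= (B1 ^ 2 + B1 + Rabs (B2 - B1)) / 6 /\ Cmod a3 <= B1 * (3 * B1 + 2) / 12).
Proof.
assert (HB1C : RtoC B1 <> 0) by (intros E; apply RtoC_inj in E; lra).
assert (Ed1 : d1 = (- c1)%C).
{ transitivity ((B1 * d1) / B1)%C; [field; exact HB1C|].
  rewrite Hd1, <- Hc1. field. exact HB1C. }
rewrite Ed1 in Hd, Hd2. rewrite Cmod_opp in Hd.
set (D := Rabs (B2 - B1)).
assert (HD : 0 <= D) by apply Rabs_pos.
(* In this form the term [B1 t] cancels the loss in [B1 (1 - t)], leaving only [D t]. *)
assert (HB2 : Rabs B2 <= B1 + D).
{ replace B2 with (B1 + (B2 - B1)) at 1 by ring.
  eapply Rle_trans; [apply Rabs_triang|]. rewrite (Rabs_pos_eq B1) by lra. unfold D; lra. }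
assert (Ea2 : 2 * Cmod a2 = B1 * Cmod c1).
{ rewrite <- !RtoC_scal_Cmod by lra. now rewrite Hc1. }
assert (S1 : Cmod (B2 * (c1 * c1))%C <= (B1 + D) * Cmod c1 ^ 2).
{ rewrite !Cmod_mult, Cmod_R. replace (Cmod c1 ^ 2) with (Cmod c1 * Cmod c1) by ring.
  apply Rmult_le_compat_r; [|exact HB2]. apply Rmult_le_pos; apply Cmod_ge_0. }
(* Sum of the two second-order equations. *)
assert (S2 : 4 * Cmod a2 ^ 2 <= B1 * (Cmod c2 + Cmod d2) + 2 * ((B1 + D) * Cmod c1 ^ 2)).
{ replace (4 * Cmod a2 ^ 2) with (4 * (Cmod a2 * Cmod a2)) by ring.
  rewrite <- Cmod_mult, <- RtoC_scal_Cmod by lra.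
  replace (4 * (a2 * a2))%C with (B1 * c2 + B1 * d2 + 2 * (B2 * (c1 * c1)))%C.
  - eapply Rle_trans; [apply Cmod_triangle|].
    eapply Rle_trans; [apply Rplus_le_compat_r, Cmod_triangle|].
    rewrite !RtoC_scal_Cmod by lra. lra.
  - transitivity ((B1 * c2 + B2 * (c1 * c1)) + (B1 * d2 + B2 * (- c1 * - c1)))%C; [ring|].
    rewrite Hc2, Hd2. ring. }
(* Difference of the two second-order equations. *)
assert (S3 : 12 * Cmod a3 <= 12 * Cmod a2 ^ 2 + B1 * (Cmod c2 + Cmod d2)).
{ replace (Cmod a2 ^ 2) with (Cmod a2 * Cmod a2) by ring.
  rewrite <- Cmod_mult, <- !RtoC_scal_Cmod by lra.
  replace (12 * a3)%C with (12 * (a2 * a2) + B1 * c2 + - (B1 * d2))%C.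
  - eapply Rle_trans; [apply Cmod_triangle|]. rewrite Cmod_opp.
    eapply Rle_trans; [apply Rplus_le_compat_r, Cmod_triangle|].
    rewrite !RtoC_scal_Cmod by lra. lra.
  - transitivity (12 * (a2 * a2) + (B1 * c2 + B2 * (c1 * c1))
      - (B1 * d2 + B2 * (- c1 * - c1)))%C; [ring|].
    rewrite Hc2, Hd2. ring. }
(* The second-order equation for [f] alone, solved for [a3]. *)
assert (S4 : 6 * Cmod a3 <= 4 * Cmod a2 ^ 2 + B1 * Cmod c2 + (B1 + D) * Cmod c1 ^ 2).
{ replace (Cmod a2 ^ 2) with (Cmod a2 * Cmod a2) by ring.
  rewrite <- Cmod_mult, <- !RtoC_scal_Cmod by lra.
  replace (6 * a3)%C with (4 * (a2 * a2) + B1 * c2 + B2 * (c1 * c1))%C.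
  - eapply Rle_trans; [apply Cmod_triangle|].
    eapply Rle_trans; [apply Rplus_le_compat_r, Cmod_triangle|].
    rewrite !RtoC_scal_Cmod by lra. lra.
  - transitivity (4 * (a2 * a2) + (B1 * c2 + B2 * (c1 * c1)))%C; [ring|].
    rewrite Hc2. ring. }
pose proof (Cmod_ge_0 c1). pose proof (Cmod_ge_0 c2). pose proof (Cmod_ge_0 d2).
set (t := Cmod c1 ^ 2) in *.
assert (Ht : 0 <= t <= 1) by (split; [apply pow2_ge_0|lra]).
assert (Ea2' : Cmod a2 ^ 2 = B1 ^ 2 * t / 4).
{ replace (Cmod a2) with (B1 * Cmod c1 / 2) by lra. unfold t. field. }
assert (Hc1' : Cmod c1 <= 1) by (unfold t in Ht; nra).
assert (U : B1 * Cmod c2 <= B1 * (1 - t)) by (apply Rmult_le_compat_l; lra).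
assert (V : B1 * Cmod d2 <= B1 * (1 - t)) by (apply Rmult_le_compat_l; lra).
assert (Q : B1 ^ 2 * t <= B1 ^ 2) by (pose proof (pow2_ge_0 B1); nra).
assert (Dt : D * t <= D) by nra.
assert (Bt : 0 <= B1 * t) by nra.
(* For [6 |a2|^2], half of [S2] gives [B1 + D t] and [Ea2'] gives [B1^2 t]. The bounds for [a3] are
   [6 |a3| <= B1^2 t + B1 + D t] from [S4] and [12 |a3| <= 3 B1^2 t + 2 B1 (1 - t)] from [S3]. *)
repeat split; nra.
Qed.

End Bounds.

(** * Transport to Cplx *)

(* Imported only here: from now on RtoC, Re, Im, Cinv and Cdiv are those of
   Defs, while the notations of C_scope keep denoting Coquelicot's operations. *)
Import Defs.

Definition toC (z : Cplx) : C := (Defs.Re z, Defs.Im z).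
Definition ofC (z : C) : Cplx := mkC (fst z) (snd z).
Definition transported (f : Cplx -> Cplx) (z : C) : C := toC (f (ofC z)).

Lemma toC_ofC z : toC (ofC z) = z.
Proof. now destruct z. Qed.

Lemma ofC_toC z : ofC (toC z) = z.
Proof. now destruct z. Qed.

Lemma transported_toC f z : transported f (toC z) = toC (f z).
Proof. unfold transported. now rewrite ofC_toC. Qed.

Lemma toC_RtoC x : toC (RtoC x) = Complex.RtoC x.
Proof. reflexivity. Qed.

Lemma toC_Cadd z w : toC (Cadd z w) = (toC z + toC w)%C.
Proof. reflexivity. Qed.

Lemma toC_Csub z w : toC (Csub z w) = (toC z - toC w)%C.
Proof. reflexivity. Qed.

Lemma toC_Cmul z w : toC (Cmul z w) = (toC z * toC w)%C.
Proof. reflexivity. Qed.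

(* Both inverses are 0 at 0, so no hypothesis w <> 0 is needed. *)
Lemma toC_Cdiv z w : toC (Cdiv z w) = (toC z / toC w)%C.
Proof.
unfold Cdiv, Complex.Cdiv. rewrite toC_Cmul. f_equal.
destruct w as [x y]. unfold toC, Complex.Cinv; simpl. now rewrite !Rmult_1_r.
Qed.

Lemma Cnorm_Cmod z : Cnorm z = Cmod (toC z).
Proof. unfold Cnorm, Cmod; simpl. now rewrite !Rmult_1_r. Qed.

Lemma inD_ofC (z : C) : inD (ofC z) <-> Cmod z < 1.
Proof. unfold inD. now rewrite Cnorm_Cmod, toC_ofC. Qed.

(** Multiplying the quotient estimate by [|h|] gives the increment form; the increment [h = 0],
    which the quotient excludes, is trivial. *)
Lemma has_cderiv_transported f z l :
  has_cderiv f z l -> cderiv (transported f) (toC z) (toC l).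
Proof.
intros Hf. apply cderiv_eps. intros eps Heps.
destruct (Hf eps Heps) as (d & Hd & K). exists d. split; [exact Hd|]. intros h Hh.
rewrite transported_toC.
destruct (Ceq_dec h 0) as [->|Hh0].
- rewrite Cplus_0_r, transported_toC, Cmod_0, Rmult_0_r.
  replace (toC (f z) - toC (f z) - toC l * 0)%C with (Complex.RtoC 0) by ring.
  rewrite Cmod_0. apply Rle_refl.
- specialize (K (ofC h)). rewrite !Cnorm_Cmod, toC_ofC, toC_Csub, toC_Cdiv, toC_Csub, toC_ofC in K.
  unfold transported.
  replace (ofC (toC z + h)%C) with (Cadd z (ofC h)) by reflexivity.
  set (D := (toC (f (Cadd z (ofC h))) - toC (f z))%C) in *.
  replace (D - toC l * h)%C with ((D / h - toC l) * h)%C by (field; exact Hh0).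
  rewrite Cmod_mult. apply Rmult_le_compat_r; [apply Cmod_ge_0|]. left. apply K; [|exact Hh].
  intros E. apply Hh0. rewrite <- (toC_ofC h), E. reflexivity.
Qed.

Lemma holo_D_transported f f' : holo_D f f' ->
  forall z, Cmod z < 1 -> cderiv (transported f) z (transported f' z).
Proof.
intros H z Hz. rewrite <- (toC_ofC z) at 1. apply has_cderiv_transported, H.
now apply inD_ofC.
Qed.

Lemma transported_0 f : transported f 0 = toC (f Czero).
Proof. reflexivity. Qed.

(** Regrouping gives the shape [1 + z q z] with [q = g'' / g'], at zeros of [g'] as well, because
    division is multiplication by a total inverse. *)
Lemma transported_conv_expr g' g'' (z : C) :
  transported (conv_expr g' g'') z
  = (1 + z * (transported g'' z / transported g' z))%C.
Proof.
unfold transported, conv_expr.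
rewrite toC_Cadd, toC_Cdiv, toC_Cmul, toC_ofC. unfold Complex.Cdiv.
now rewrite Cmult_assoc.
Qed.

(** It serves for [f] and for [F] alike; only the derivative [k] of [g'' / g'] at 0 has to be
    computed separately. *)
Lemma conv_expr_coefficients (phi phi' phi'' g' g'' : Cplx -> Cplx) (B1 B2 : R) (k : C) :
  holo_D phi phi' -> holo_D phi' phi'' -> phi Czero = Cone ->
  phi' Czero = RtoC B1 -> phi'' Czero = RtoC (2 * B2) -> 0 < B1 ->
  subord (conv_expr g' g'') phi ->
  cderiv (fun z => transported g'' z / transported g' z)%C 0 k ->
  exists c1 c2,
    (B1 * c1)%C = (transported g'' 0 / transported g' 0)%C /\
    (B1 * c2 + B2 * (c1 * c1))%C = k /\ Cmod c2 + Cmod c1 ^ 2 <= 1.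
Proof.
intros Hphi Hphi' Hphi0 HB1 HB2 HB1pos (w & [w' Hw] & HwD & Hw0 & Heq) Hk.
apply (subordinate_coefficients (transported phi) (transported phi') (transported w)
  (fun z => transported g'' z / transported g' z)%C); try exact Hk.
- intros E. apply RtoC_inj in E. lra.
- exact (holo_D_transported _ _ Hphi).
- replace (2 * B2)%C with (transported phi'' 0).
  + apply (holo_D_transported _ _ Hphi'). rewrite Cmod_0. lra.
  + rewrite transported_0, HB2, toC_RtoC. apply RtoC_mult.
- rewrite transported_0, Hphi0. reflexivity.
- rewrite transported_0, HB1. reflexivity.
- intros z Hz. split.
  + unfold transported. rewrite <- Cnorm_Cmod. apply HwD. now apply inD_ofC.
  + eexists. exact (holo_D_transported _ _ Hw z Hz).
- rewrite transported_0, Hw0. reflexivity.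
- intros z Hz. rewrite <- transported_conv_expr. unfold transported.
  rewrite ofC_toC, Heq; [reflexivity|]. now apply inD_ofC.
Qed.

Theorem theorem3
  (phi phi' phi'' : Cplx -> Cplx) (B1 B2 : R)
  (Hphi1 : holo_D phi phi') (Hphi2 : holo_D phi' phi'')
  (Hphi0 : phi Czero = Cone)
  (HB1 : phi' Czero = RtoC B1)            (* B1 = phi'(0) *)
  (HB2 : phi'' Czero = RtoC (2 * B2))     (* B2 = phi''(0)/2, real *)
  (HB1pos : 0 < B1)
  (f f' f'' f''' F F' F'' : Cplx -> Cplx)
  (HfA : in_A f f') (Hf2 : holo_D f' f'') (Hf3 : holo_D f'' f''')
  (HF1 : holo_D F F') (HF2 : holo_D F' F'')
  (Hsigma : bi_univalent_with_inverse f F)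
  (Hsubf : subord (conv_expr f' f'') phi)
  (HsubF : subord (conv_expr F' F'') phi) :
  let a2 := Cdiv (f'' Czero) (RtoC 2) in
  let a3 := Cdiv (f''' Czero) (RtoC 6) in
  Cnorm a2 <= Rmin (sqrt ((B1 ^ 2 + B1 + Rabs (B2 - B1)) / 6)) (B1 / 2) /\
  Cnorm a3 <= Rmin ((B1 ^ 2 + B1 + Rabs (B2 - B1)) / 6) (B1 * (3 * B1 + 2) / 12).
Proof.
intros a2 a3.
destruct HfA as (Hf1 & Hf0 & Hf'0).
destruct Hsigma as ((_ & Hinj) & _ & r & Hr & Hinv).
assert (D0 : Cmod 0 < 1) by (rewrite Cmod_0; lra).
assert (Ef' : transported f' 0 = 1) by (rewrite transported_0, Hf'0; reflexivity).
assert (E2 : transported f'' 0 = (2 * toC a2)%C).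
{ unfold a2. rewrite toC_Cdiv, transported_0, toC_RtoC. field. }
assert (E3 : transported f''' 0 = (6 * toC a3)%C).
{ unfold a3. rewrite toC_Cdiv, transported_0, toC_RtoC. field. }
(* The inverse relation gives [f (F 0) = 0 = f 0], and injectivity of [f] on the disk concludes. *)
assert (HF0 : F Czero = Czero).
{ destruct (Hinv Czero) as [H1 H2].
  { rewrite Cnorm_Cmod. change (toC Czero) with (Complex.RtoC 0). now rewrite Cmod_0. }
  apply Hinj; [exact H1| |now rewrite H2].
  unfold inD. rewrite Cnorm_Cmod. exact D0. }
(* The third coefficient expression is the derivative of [f'' / f'] at 0 by the quotient rule, with
   [f' 0 = 1]. *)
destruct (conv_expr_coefficients phi phi' phi'' f' f'' B1 B2
   (6 * toC a3 - 4 * (toC a2 * toC a2))%C) as (c1 & c2 & Hc1 & Hc2 & Hc); try assumption.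
{ replace (6 * toC a3 - 4 * (toC a2 * toC a2))%C with
    (transported f''' 0 * / transported f' 0 + transported f'' 0 *
      - (transported f'' 0 / (transported f' 0 * transported f' 0)))%C
    by (rewrite Ef', E2, E3; field; apply C1_nz).
  apply (cderiv_mult (transported f'') (fun z => / transported f' z)%C);
    [now apply (holo_D_transported _ _ Hf3)|].
  apply cderiv_inv; [rewrite Ef'; apply C1_nz|now apply (holo_D_transported _ _ Hf2)]. }
(* The radius is cut down to [Rmin r 1] so that the inverse relation is used only inside the disk,
   where [F] is differentiable. *)
destruct (cderiv_inverse_log_derivative (transported f) (transported f') (transported f'')
  (transported F) (transported F') (transported F'') (transported f''' 0) (Rmin r 1))
  as [EF DF]; try assumption; try now apply holo_D_transported.
{ split; [apply Rmin_glb_lt; lra|apply Rmin_r]. }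
{ intros w Hw. pose proof (Rmin_l r 1).
  destruct (Hinv (ofC w)) as [H1 H2]; [rewrite Cnorm_Cmod, toC_ofC; lra|].
  unfold transported. rewrite ofC_toC, H2, toC_ofC, <- Cnorm_Cmod. now split. }
{ rewrite transported_0, HF0. reflexivity. }
destruct (conv_expr_coefficients phi phi' phi'' F' F'' B1 B2 _
   Hphi1 Hphi2 Hphi0 HB1 HB2 HB1pos HsubF DF) as (d1 & d2 & Hd1 & Hd2 & Hd).
destruct (coefficient_bounds B1 B2 (toC a2) (toC a3) c1 c2 d1 d2)
  as [[A1 A2] [A3 A4]]; try assumption.
- rewrite Hc1, Ef', E2. field.
- rewrite Hd1, EF, E2. reflexivity.
- rewrite Hd2, E2, E3. ring.
- rewrite !Cnorm_Cmod. split; apply Rmin_glb; try assumption.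
  rewrite <- (sqrt_pow2 (Cmod (toC a2))) by apply Cmod_ge_0. now apply sqrt_le_1_alt.
Qed.
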